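(* Let $M$ be a countable set with $n \ge 3$ elements ($n\in\{3,4,\ldots,\infty\}$), let $\Gamma \curvearrowright M$ be a transitive permutation group, let $c \in M$, and let $\xi$ be a fixed endpoint of the Ważewski dendrite $W = W_n$. Let $\kappa\colon\widehat X\to M$ be a kaleidoscopic coloring, and let $\kappa^*\colon\widehat X\to M$ be the root-kaleidoscopic coloring given by $$\kappa^*(a)=\sigma(\kappa(\rho(x)))\cdot\kappa(a)\qquad\text{for } x\in X,\ a\in\hat x,$$ where $\sigma\colon M\to\mathrm{Sym}(M)$ is a function such that $\sigma(c)=1_{\mathrm{Sym}(M)}$ and $\sigma(a)\cdot a=c$ for all $a\in M$. Then $$\mathcal{K}^*(\Gamma_c) = \mathcal{K}(\Gamma)_\xi,$$ where the groups $\mathcal{K}^*(\Gamma_c)$ and $\mathcal{K}(\Gamma)$ are constructed using the colorings $\kappa^*$ and $\kappa$, respectively.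
   Context: A permutation group $\Gamma \curvearrowright M$ is a closed subgroup of $\mathrm{Sym}(M)$ (pointwise convergence topology); $\Gamma_c$ is the stabilizer of $c$ in $\Gamma$. A dendrite is a compact, metrizable, locally connected, uniquely arcwise connected topological space. For a point $x$ of a dendrite $D$, $\hat{x}$ is the set of connected components of $D \setminus \{x\}$; $x$ is an endpoint if $|\hat x| = 1$ and a branch point of order $|\hat x|$ if $|\hat x| \ge 3$. For $n \in \{3,4,\ldots,\infty\}$, the Ważewski dendrite $W = W_n$ is the unique (up to homeomorphism) dendrite in which every branch point has order $n$ and the set of branch points is dense. $X$ is the set of branch points of $W$ and $\widehat{X} = \bigsqcup_{x \in X} \hat{x}$. For $x \in X$ and $y \in W\setminus\{x\}$, $\Phi(x,y) \in \hat x$ is the component of $W \setminus \{x\}$ containing $y$, and $\rho(x)=\Phi(x,\xi)$ is the component containing the root $\xi$. $[x,y]$ is the unique arc joining $x$ and $y$, and $(x,y) = [x,y]\setminus\{x,y\}$. A kaleidoscopic coloring is a map $\kappa\colon \widehat X \to M$ such that each restriction $\kappa_x = \kappa|_{\hat x}\colon \hat x \to M$ is a bijection and for all $x \neq y$ in $X$ and $a \neq b$ in $M$ there is $z \in X \cap (x,y)$ with $\kappa(\Phi(z,x)) = a$ and $\kappa(\Phi(z,y)) = b$. A root-kaleidoscopic coloring (with distinguished element $c$ and root $\xi$) is a map $\kappa^*\colon \widehat X \to M$ such that each restriction $\kappa^*_x=\kappa^*|_{\hat x}\colon \hat x \to M$ is a bijection, $\kappa^*(\rho(x)) = c$ for all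 $x \in X$, and for all $x \in X$, $y \in (\xi,x)$ and $a \in M\setminus\{c\}$ there is $z \in X\cap (y,x)$ with $\kappa^*(\Phi(z,x)) = a$. The function $\kappa^*$ defined by the formula in the claim is a root-kaleidoscopic coloring. For $g \in \mathrm{Homeo}(W)$ and $x\in X$, put $\alpha_\kappa(g,x)=\kappa_{g\cdot x}\circ g|_{\hat x}\circ\kappa_x^{-1}\in\mathrm{Sym}(M)$; for $g\in\mathrm{Homeo}(W)_\xi$ (the stabilizer of $\xi$), define $\alpha_{\kappa^*}(g,x)$ by the same formula with $\kappa^*$ in place of $\kappa$. The kaleidoscopic group is $\mathcal{K}(\Gamma) = \{g \in \mathrm{Homeo}(W) : \alpha_\kappa(g,x) \in \Gamma \text{ for all } x \in X\}$, and $\mathcal{K}(\Gamma)_\xi$ is the stabilizer of $\xi$ in it. For a permutation group $\Delta\curvearrowright M$ fixing $c$, the root-kaleidoscopic group is $\mathcal{K}^*(\Delta) = \{g \in \mathrm{Homeo}(W)_\xi : \alpha_{\kappa^*}(g,x)\in\Delta \text{ for all } x \in X\}$.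
   Formalization: The formal theorem additionally assumes that σ(a) lies in Γ for every a in M (not merely in Sym(M)); without this the equality fails, e.g. for M={0,1,2}, Γ=Z/3, c=0, σ(1)=(0 1), σ(2)=rotation by 1. *)

(* Defs.v *)
From HB Require Import structures.
From mathcomp Require Import all_boot all_order all_algebra.
From mathcomp Require Import all_classical all_reals topology.

Set Implicit Arguments.
Unset Strict Implicit.
Unset Printing Implicit Defensive.

Import Order.TTheory GRing.Theory Num.Theory.
Import numFieldTopology.Exports.

Local Open Scope classical_set_scope.
Local Open Scope card_scope.
Local Open Scope ring_scope.

(* An element of {3, 4, ..., oo} is encoded as an [option nat], with [None]
   standing for (countable) infinity. *)
Definition at_least3 (n : option nat) : bool :=
  if n is Some k then (3 <= k)%N else true.

Definition has_card (T : Type) (n : option nat) (A : set T) : Prop :=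
  if n is Some k then A #= `I_k else A #= [set: nat].

(** Permutation groups: groups of permutations of T are sets of functions
    T -> T, all of whose elements are bijective. *)

Definition Symmetric (T : Type) : set (T -> T) := [set f | bijective f].

Definition stabilizer (T : Type) (G : set (T -> T)) (t : T) : set (T -> T) :=
  [set f | G f /\ f t = t].

(* Closedness is relative to Sym(M), which is not closed in M^M when M is
   infinite. *)
Definition closed_in_Symmetric (M : choiceType) (G : set (M -> M)) : Prop :=
  closed (G : set (subspace
    (@Symmetric M : set {ptws M -> discrete_topology M}))).

Definition permutation_group (M : choiceType) (G : set (M -> M)) : Prop :=
  [/\ G `<=` @Symmetric M,
      G idfun,
      forall f g, G f -> G g -> G (f \o g),
      forall f g, G f -> cancel f g -> cancel g f -> G g
    & closed_in_Symmetric G].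

Definition transitive_on (T : Type) (G : set (T -> T)) : Prop :=
  forall a b : T, exists2 f, G f & f a = b.

Definition Homeo (T : topologicalType) : set (T -> T) :=
  [set f | continuous f /\
     exists g : T -> T, [/\ continuous g, cancel f g & cancel g f]].

(** Dendrites *)

Definition metrizable (R : realType) (T : topologicalType) : Prop :=
  exists d : T -> T -> R,
    [/\ forall x, d x x = 0,
        forall x y, d x y = 0 -> x = y,
        forall x y, d x y = d y x,
        forall x y z, d x z <= d x y + d y z
      & forall x, nbhs x =
          filter_from [set e : R | 0 < e] (fun e => [set y | d x y < e])].

Definition locally_connected (T : topologicalType) : Prop :=
  forall (x : T) (U : set T), nbhs x U ->
    exists V : set T, [/\ open V, connected V, V x & V `<=` U].

(* A is homeomorphic to [0, 1] through f, with inverse g, and has endpoints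
   x = f 0 and y = f 1. *)
Definition is_arc (R : realType) (T : topologicalType) (x y : T) (A : set T)
    : Prop :=
  exists (f : R -> T) (g : T -> R),
    [/\ f @` `[0, 1] = A,
        {in `[0, 1], cancel f g},
        {within `[0, 1], continuous f},
        {within A, continuous g}
      & f 0 = x /\ f 1 = y].

Definition uniquely_arcwise_connected (R : realType) (T : topologicalType)
    : Prop :=
  forall x y : T, x <> y -> exists! A : set T, is_arc R x y A.

Definition dendrite (R : realType) (T : topologicalType) : Prop :=
  [/\ compact [set: T], metrizable R T, locally_connected T
    & uniquely_arcwise_connected R T].

(* (x, y) for x <> y; it is empty when x = y. *)
Definition open_arc (R : realType) (T : topologicalType) (x y : T) : set T :=
  xget set0 (@is_arc R T x y) `\` [set x; y].

Definition Phi (T : topologicalType) (x y : T) : set T :=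
  connected_component (~` [set x]) y.

Definition hat (T : topologicalType) (x : T) : set (set T) :=
  Phi x @` (~` [set x]).

Definition is_endpoint (T : topologicalType) (x : T) : Prop :=
  hat x #= `I_1.

Definition branch (T : topologicalType) : set T :=
  [set x | `I_3 #<= hat x].

Definition Wazewski (R : realType) (n : option nat) (T : topologicalType)
    : Prop :=
  [/\ dendrite R T,
      forall x : T, branch x -> has_card n (hat x)
    & dense (@branch T)].

(** Colorings: a map on the disjoint union of the [hat x], x a branch point, is
    given as a function k of x and a component C; only the values k x C with
    [branch x] and [hat x C] are meaningful. *)

Definition kaleidoscopic (R : realType) (W : topologicalType) (M : Type)
    (k : W -> set W -> M) : Prop :=
  (forall x : W, branch x -> set_bij (hat x) [set: M] (k x)) /\
  (forall x y : W, branch x -> branch y -> x <> y ->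
   forall a b : M, a <> b ->
     exists z : W, [/\ branch z, open_arc R x y z,
                   k z (Phi z x) = a & k z (Phi z y) = b]).

Definition root_kaleidoscopic (R : realType) (W : topologicalType) (M : Type)
    (c : M) (xi : W) (k : W -> set W -> M) : Prop :=
  [/\ forall x : W, branch x -> set_bij (hat x) [set: M] (k x),
      forall x : W, branch x -> k x (Phi x xi) = c
    & forall x y : W, branch x -> open_arc R xi x y ->
      forall a : M, a <> c ->
        exists z : W, [/\ branch z, open_arc R y x z & k z (Phi z x) = a]].

(* The local action of g at x; 'pinv_ is the inverse of k x on hat x. *)
Definition alpha (W : topologicalType) (M : Type) (k : W -> set W -> M)
    (g : W -> W) (x : W) : M -> M :=
  k (g x) \o (fun C => g @` C) \o 'pinv_(fun=> set0) (hat x) (k x).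

Definition K (W : topologicalType) (M : Type) (k : W -> set W -> M)
    (G : set (M -> M)) : set (W -> W) :=
  [set g | Homeo g /\ forall x : W, branch x -> G (alpha k g x)].

Definition Kstar (W : topologicalType) (M : Type) (k : W -> set W -> M)
    (xi : W) (D : set (M -> M)) : set (W -> W) :=
  [set g | stabilizer (@Homeo W) xi g /\
           forall x : W, branch x -> D (alpha k g x)].

(* Main.v *)
Require Import Defs.
From HB Require Import structures.
From mathcomp Require Import all_boot all_order all_algebra.
From mathcomp Require Import all_classical all_reals topology.

Set Implicit Arguments.
Unset Strict Implicit.
Unset Printing Implicit Defensive.

Local Open Scope classical_set_scope.

(** A homeomorphism g permutes the components [hat x] compatibly with points:
    the image of [Phi x y] is [Phi (g x) (g y)].  Hence if g fixes the root xi,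
    it sends the root component rho(x) to rho(g x).  Writing r and r' for the
    kappa-colors of rho(x) and rho(g x), the formula defining kappa* says that
    kappa* at x is kappa at x followed by [sigma r], and likewise with r' at
    g x.  The two local actions are therefore intertwined by values of sigma:
      alpha* (g, x) o sigma r = sigma r' o alpha (g, x).
    Since [sigma r] and [sigma r'] belong to Gamma, one local action lies in
    Gamma if and only if the other does ([Kstar_local_Gamma]).
    Moreover alpha (g, x) sends r to r', while [sigma r] and [sigma r'] send r
    and r' to c, so alpha* (g, x) automatically fixes c
    ([alphastar_root]).  Thus, among the
    homeomorphisms fixing xi, the two groups are cut out by equivalent
    conditions. *)

(** The image is connected, contains [g y], and avoids [g x] by injectivity. *)
Lemma image_Phi_subset (W : topologicalType) (g : W -> W) (x y : W) :
  continuous g -> injective g -> g @` Phi x y `<=` Phi (g x) (g y).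
Proof.
move=> gC gI _ [z zxy <-].
have [xy|/eqP xy] := eqVneq x y.
  (* the component of a point outside the set is empty *)
  by move: zxy; rewrite /Phi connected_component_out // xy; apply.
exists (g @` Phi x y); last by exists z.
split.
- by exists y => //; apply: connected_component_refl => /= e; apply: xy.
- move=> _ [w /connected_component_sub wx <-] /gI; exact: wx.
- apply: connected_continuous_connected; first exact: component_connected.
  exact: continuous_subspaceT.
Qed.

Lemma image_Phi (W : topologicalType) (g : W -> W) (x y : W) :
  Homeo g -> g @` Phi x y = Phi (g x) (g y).
Proof.
move=> [gC [h [hC gK hK]]]; apply/seteqP; split.
  exact/image_Phi_subset/(can_inj gK).
move=> z zxy; exists (h z); last exact: hK.
rewrite -[x]gK -[y]gK.
by apply: (image_Phi_subset hC (can_inj hK)); exists z.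
Qed.

Lemma image_hat (W : topologicalType) (g : W -> W) (x : W) :
  Homeo g -> image^~ g @` hat x = hat (g x).
Proof.
move=> gH; have [_ [h [_ gK hK]]] := gH; apply/seteqP; split.
  move=> _ [_ [y yx <-] <-]; exists (g y); last by rewrite image_Phi.
  by move=> /(can_inj gK).
move=> _ [y yx <-]; exists (Phi x (h y)); last by rewrite image_Phi // hK.
by exists (h y) => // hyx; apply: yx; rewrite /= -hyx hK.
Qed.

Lemma Homeo_branch (W : topologicalType) (g : W -> W) (x : W) :
  Homeo g -> branch x -> branch (g x).
Proof.
move=> gH bx; have [_ [h [_ gK _]]] := gH.
rewrite /branch /= -image_hat //; apply: card_le_trans bx _.
suff /card_eqPle[] : (image^~ g @` hat x #= hat x)%card by [].
apply: inj_card_eq => A B _ _ /= AB.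
have hgI C : h @` (g @` C) = C.
  by rewrite image_comp -[RHS]image_id; apply: eq_imagel => z _; exact: gK.
by rewrite -[LHS]hgI AB hgI.
Qed.

Lemma endpoint_not_branch (W : topologicalType) (x : W) :
  is_endpoint x -> ~ branch x.
Proof.
move=> x1 x3; have /card_eqPle[x1' _] := x1.
by have := card_le_trans x3 x1'; rewrite card_le_II.
Qed.

Lemma hat_Phi_endpoint (W : topologicalType) (x xi : W) :
  is_endpoint xi -> branch x -> hat x (Phi x xi).
Proof.
move=> exi bx; exists xi => // xix; apply: (endpoint_not_branch exi).
by rewrite xix.
Qed.

(** This equation characterizes [alpha], sparing later arguments the partial
    inverse of the coloring. *)
Lemma alphaE (W : topologicalType) (M : Type) (k : W -> set W -> M)
    (g : W -> W) (x : W) (C : set W) :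
  set_bij (hat x) [set: M] (k x) -> hat x C ->
  alpha k g x (k x C) = k (g x) (g @` C).
Proof. by move=> [_ kI _] xC; rewrite /alpha /= pinvKV // inE. Qed.

Lemma permutation_group_intertwine (M : choiceType) (G : set (M -> M))
    (s t f h : M -> M) :
  permutation_group G -> G s -> G t -> f \o s = t \o h -> G f <-> G h.
Proof.
move=> [Gbij _ GM GV _] Gs Gt fsth.
have [s' sK s'K] := Gbij _ Gs; have [t' tK t'K] := Gbij _ Gt.
have -> : f = t \o h \o s'.
  by rewrite -fsth; apply/funext => m /=; rewrite s'K.
split=> [Gf|Gh]; last exact: GM _ _ (GM _ _ Gt Gh) (GV _ _ Gs sK s'K).
have -> : h = t' \o (t \o h \o s') \o s.
  by apply/funext => m /=; rewrite sK tK.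
exact: GM _ _ (GM _ _ (GV _ _ Gt tK t'K) Gf) Gs.
Qed.

Section recoloring.
Context (M : choiceType) (W : topologicalType) (c : M) (xi : W).
Context (kappa kappastar : W -> set W -> M) (sigma : M -> M -> M).
Hypothesis xi_endpoint : is_endpoint xi.
Hypothesis kappa_bij :
  forall x, branch x -> set_bij (hat x) [set: M] (kappa x).
Hypothesis kappastar_bij :
  forall x, branch x -> set_bij (hat x) [set: M] (kappastar x).
Hypothesis kappastarE : forall x, branch x -> forall C, hat x C ->
  kappastar x C = sigma (kappa x (Phi x xi)) (kappa x C).
Context (g : W -> W) (x : W).
Hypotheses (g_homeo : Homeo g) (g_xi : g xi = xi) (x_branch : branch x).

Let r := kappa x (Phi x xi).
Let r' := kappa (g x) (Phi (g x) xi).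

Lemma alpha_intertwine :
  alpha kappastar g x \o sigma r = sigma r' \o alpha kappa g x.
Proof.
apply/funext => m /=.
have [_ _ /(_ m I)[C xC <-]] := kappa_bij x_branch.
rewrite -(kappastarE x_branch xC) !alphaE //; try by auto.
apply: kappastarE; first exact: Homeo_branch.
by rewrite -image_hat //; exists C.
Qed.

Lemma alpha_root : alpha kappa g x r = r'.
Proof.
rewrite alphaE; [|exact: kappa_bij|exact: hat_Phi_endpoint].
by rewrite image_Phi // g_xi.
Qed.

Lemma alphastar_root : (forall a, sigma a a = c) -> alpha kappastar g x c = c.
Proof.
move=> sigma_c; rewrite -{1}(sigma_c r).
by have /= -> := congr1 (@^~ r) alpha_intertwine; rewrite alpha_root.
Qed.

Lemma Kstar_local_Gamma (Gamma : set (M -> M)) :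
  permutation_group Gamma -> (forall a, Gamma (sigma a)) ->
  Gamma (alpha kappastar g x) <-> Gamma (alpha kappa g x).
Proof.
by move=> GG Gs; apply: permutation_group_intertwine alpha_intertwine.
Qed.

End recoloring.

Theorem proposition4p6 (R : realType) (n : option nat) (hn : at_least3 n)
  (M : countType) (hM : has_card n [set: M])
  (Gamma : set (M -> M))
  (hGamma : permutation_group Gamma) (hGamma_tr : transitive_on Gamma)
  (c : M)
  (W : topologicalType) (hW : Wazewski R n W)
  (xi : W) (hxi : is_endpoint xi)
  (kappa : W -> set W -> M) (hkappa : kaleidoscopic R kappa)
  (sigma : M -> M -> M)
  (hsigma_Gamma : forall a : M, Gamma (sigma a))
  (hsigma_c : sigma c = idfun)
  (hsigma : forall a : M, sigma a a = c)
  (kappastar : W -> set W -> M)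
  (hkappastar_root : root_kaleidoscopic R c xi kappastar)
  (hkappastar : forall x : W, branch x -> forall a : set W, hat x a ->
     kappastar x a = sigma (kappa x (Phi x xi)) (kappa x a)) :
  Kstar kappastar xi (stabilizer Gamma c) = stabilizer (K kappa Gamma) xi.
Proof.
have [kappa_bij _] := hkappa; have [kappastar_bij _ _] := hkappastar_root.
apply/seteqP; split=> g.
- move=> [[gH gxi] gG]; split => //; split => // x bx.
  have [Gx _] := gG x bx.
  by apply/(Kstar_local_Gamma kappa_bij kappastar_bij hkappastar).
- move=> [[gH gG] gxi]; split => // x bx; split.
    by apply/(Kstar_local_Gamma kappa_bij kappastar_bij hkappastar); auto.
  exact: (alphastar_root hxi kappa_bij kappastar_bij hkappastar).
Qed.
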